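(* Let $X=(X,d,\mu)$ be a Borel metric measure space in which every closed ball of positive radius has positive and finite measure, let $r>0$, and let $E(X)$ be a Banach function space on $X$ with associated constants $\alpha(A)$ (for $A\subset X$ measurable with $\mu(A)<\infty$). Suppose that the averaging operator satisfies $A_r(E(X))\subset E(X)$ and that the following conditions are satisfied: (1) $X$ is $r$-doubling; (2) $\sup\left\{\left\|\frac{\alpha(B(x,r))\,\chi_{B(x,2r)}}{\mu(B(x,r))}\right\|_E \;\middle|\; x\in X\right\}<\infty$. If $A_r:E(X)\to E(X)$ is compact, then $X$ is bounded.
   Context: Setting: $X=(X,d,\mu)$ is a metric space with metric $d$ and a measure $\mu$ for which all Borel sets are measurable; $B(x,s)$ denotes the closed ball centered at $x$ of radius $s$; it is assumed that $0<\mu(B(x,s))<\infty$ for all $x\in X$, $s>0$. $L^0(X)$ is the space of (real-valued) measurable functions on $X$, with functions equal a.e. identified; $\chi_A$ is the characteristic function of $A$. Banach function space: a normed linear space $E(X)=(E(X),\|\cdot\|_E)\subset L^0(X)$ such that (B1) for each $f\in E(X)$, $\|f\|_E=\||f|\|_E$, and $\|f\|_E=0$ iff $f=0$ a.e.; (B2) for $f,g\in E(X)$, if $0\le g\le f$ a.e. then $\|g\|_E\le\|f\|_E$; (B3) for $f,f_n\in E(X)$ ($n\in\mathbb{N}$), if $0\le f_n\uparrow f$ a.e. then $\|f_n\|_E\uparrow\|f\|_E$; (B4) for every measurable $A\subset X$ with $\mu(A)<\infty$, $\chi_A\in E(X)$ and $\|\chi_A\|_E<\infty$; (B5) for each measurable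 $A\subset X$ with $\mu(A)<\infty$ there is $\alpha(A)\in(0,\infty)$ such that $\int_A|f|\,d\mu\le\alpha(A)\|f\|_E$ for all $f\in E(X)$. A choice of such constants $\alpha(A)$ is fixed. Such an $E(X)$ is a Banach space (complete). Averaging operator: $A_r:E(X)\to L^0(X)$, $A_rf(x)=\frac{1}{\mu(B(x,r))}\int_{B(x,r)}f(y)\,d\mu(y)$. For $s>0$, $X$ is $s$-doubling if there is $\gamma\ge 1$ such that $\mu(B(x,2s))\le\gamma\mu(B(x,s))$ for every $x\in X$. Compact means: maps bounded sets to relatively compact sets. *)

(* Defs.v *)
From HB Require Import structures.
From mathcomp Require Import all_boot all_order all_algebra.
From mathcomp Require Import all_classical all_reals all_analysis.
Import Order.TTheory GRing.Theory Num.Theory.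
Import numFieldNormedType.Exports.

Set Implicit Arguments.
Unset Strict Implicit.
Unset Printing Implicit Defensive.

Local Open Scope classical_set_scope.
Local Open Scope ring_scope.

(* The sigma-algebra may be strictly larger than the Borel one. *)
HB.mixin Record Metric_Measurable_isBorel (R : realType) (d : measure_display) X
    & Metric R X & Measurable d X := {
  borel_measurable : <<s [set U : set X | open U] >> `<=` @measurable d X
}.

#[short(type="borelMetricType")]
HB.structure Definition BorelMetric (R : realType) (d : measure_display) :=
  { X of Metric R X & Measurable d X & Metric_Measurable_isBorel R d X }.

(* [closed_ball] of the library is the closure of the open ball, which can be
   strictly smaller than the closed ball in a general metric space. *)
Definition cball (R : realType) (X : metricType R) (x : X) (s : R) : set X :=
  [set y | mdist x y <= s].

Definition metric_bounded (R : realType) (X : metricType R) :=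
  exists M : R, forall x y : X, mdist x y <= M.

Definition compact_operator (R : realType) (V W : normedModType R)
    (T : V -> W) :=
  forall S : set V, bounded_set S -> precompact (T @` S).

Section metric_measure.
Context (R : realType) (d : measure_display) (X : borelMetricType R d).
Variable mu : {measure set X -> \bar R}.

Definition balls_pos_finite :=
  forall (x : X) (s : R), 0 < s ->
    (0 < mu (cball x s))%E /\ (mu (cball x s) < +oo)%E.

Definition doubling (s : R) :=
  exists2 gamma : R, 1 <= gamma &
    forall x : X, (mu (cball x (2 * s)) <= gamma%:E * mu (cball x s))%E.

Definition average (r : R) (f : X -> R) (x : X) : R :=
  (fine (mu (cball x r)))^-1 * \int[mu]_(y in cball x r) f y.

Local Notation L0 := {mfun_ mu, X >-> measurableTypeR R}.

(* Constants [alpha A] bounding the L^1 norm over [A] by the norm of [V]; the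
   values of [alpha] at sets that are not measurable of finite measure are
   irrelevant. *)
Definition L1_constants (V : normedModType R) (emb : V -> L0)
    (alpha : set X -> R) :=
  forall A : set X, measurable A -> (mu A < +oo)%E ->
    0 < alpha A /\
    forall f : V, (\int[mu]_(x in A) `|emb f x : R|%:E <= (alpha A * `|f|)%:E)%E.

(* A normed space [V] included in L^0 by the injective linear map [emb]; [emb f]
   coerces to a measurable function representing the class. *)
Record is_banach_function_space (V : normedModType R) (emb : V -> L0) := {
  bfs_inj : injective emb ;
  bfs_linear : forall (a : R) (f g : V),
    (emb (a *: f + g) : X -> R) = (fun x => a * emb f x + emb g x) %[ae mu] ;
  (* [|f|] is required to belong to the space. *)
  bfs_abs : forall f : V, exists2 g : V,
    (emb g : X -> R) = (fun x => `|emb f x : R|) %[ae mu] & `|f| = `|g| ;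
  bfs_norm0 : forall f : V,
    `|f| = 0 <-> (emb f : X -> R) = cst 0 %[ae mu] ;
  bfs_mono : forall f g : V,
    (\forall x \ae mu, 0 <= (emb g x : R) <= emb f x) -> `|g| <= `|f| ;
  bfs_monotone_cvg : forall (f_ : nat -> V) (f : V),
    (\forall x \ae mu,
      [/\ forall n, 0 <= (emb (f_ n) x : R),
          nondecreasing_seq (fun n => emb (f_ n) x : R) &
          (fun n => emb (f_ n) x : R) @ \oo --> (emb f x : R)]) ->
    nondecreasing_seq (fun n => `|f_ n|) /\ (fun n => `|f_ n|) @ \oo --> `|f| ;
  (* Finiteness of the norm is automatic, norms in [V] being real numbers. *)
  bfs_indic : forall A : set X, measurable A -> (mu A < +oo)%E ->
    exists f : V, (emb f : X -> R) = \1_A %[ae mu] ;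
  bfs_L1 : exists alpha : set X -> R, L1_constants emb alpha
}.

Record banach_function_space := {
  bfs_space :> normedModType R ;
  bfs_emb : bfs_space -> L0 ;
  bfsP : is_banach_function_space bfs_emb
}.

Definition bfs_fun (E : banach_function_space) (f : E) : X -> R := bfs_emb f.

Definition bfs_constants (E : banach_function_space) (alpha : set X -> R) :=
  L1_constants (@bfs_emb E) alpha.

(* The norm of the class of [g], and +oo when that class is not in [E]. *)
Definition fnorm (E : banach_function_space) (g : X -> R) : \bar R :=
  ereal_inf [set `|f|%:E | f in [set f : E | bfs_fun f = g %[ae mu]]].

Definition average_stable (E : banach_function_space) (r : R) :=
  forall f : E, exists g : E, bfs_fun g = average r (bfs_fun f) %[ae mu].

Definition average_op (E : banach_function_space) (r : R)
    (EA : average_stable E r) (f : E) : E :=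
  projT1 (cid (EA f)).

End metric_measure.

(* Main.v *)
(* The functions f_x = alpha(B(x,r)) / mu(B(x,r)) * 1_{B(x,2r)} are bounded in E
   by condition (2).  The average A_r f_x equals that constant on B(x,r) and
   vanishes off B(x,3r); integrating over B(x,r), (B5) therefore gives
   |A_r f_x - A_r f_y|_E >= 1 as soon as d(x,y) > 4r.  As the A_r f_x lie in a
   totally bounded set, X is a finite union of bounded sets. *)

Require Import Defs.
From mathcomp Require Import all_boot all_order all_algebra.
From mathcomp Require Import all_classical all_reals all_analysis.
From mathcomp Require Import finmap measurable_realfun.
Import numFieldNormedType.Exports.

Local Open Scope classical_set_scope.
Local Open Scope ring_scope.

Import Order.TTheory GRing.Theory Num.Theory.

(** Balls of radius [e] about all points of [V] cover the compact closure of [S], and finitely many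
    suffice. The centres need not lie in [S]. *)
Lemma precompact_finite_cover {R : realType} {V : normedModType R} (S : set V)
    (e : R) : 0 < e -> precompact S ->
  exists s : seq V, forall f, S f -> exists2 v, v \in s & `|v - f| < e.
Proof.
move=> e0; rewrite precompactE compact_cover => cS.
have [|f Sf|s _ sS] := cS V setT (fun v => ball v e).
- by move=> v _; exact: ball_open.
- by exists f => //; exact: ballxx.
exists (enum_fset s) => f /subset_closure /sS[v vs].
by rewrite -ball_normE; exists v.
Qed.

(** Two points whose images lie within [e / 2] of the same net point are at distance at most [L], so
    a finite [e / 2]-net of the range cuts [X] into finitely many pieces of bounded diameter. *)
Lemma precompact_separated_bounded {R : realType} {X : metricType R}
    {V : normedModType R} (h : X -> V) (L e : R) : 0 < e ->
  precompact (range h) ->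
  (forall x y, L < mdist x y -> e <= `|h x - h y|) -> metric_bounded X.
Proof.
move=> e0 ch hL.
have e20 : 0 < e / 2 by rewrite divr_gt0.
have [s sh] := precompact_finite_cover _ _ e20 ch.
have [[x0 _]|X0] := pselect (exists x : X, True); last first.
  by exists 0 => x; exfalso; apply: X0; exists x.
suff [M hM] : exists M, forall x, (exists2 v, v \in s & `|v - h x| < e / 2) ->
    mdist x0 x <= M.
  exists (M + M) => x y; rewrite (le_trans (metric_triangle _ x0 _))//.
  by rewrite (metric_sym x) lerD// hM//; apply: sh; [exists x|exists y].
elim: {sh} s => [|v s [M IH]]; first by exists 0 => x [].
(* Induction on the net: a centre [v] near no image adds nothing; otherwise one witness [z] controls
   all points attached to [v], within [L] of [z]. *)
have [[z zv]|nz] := pselect (exists z, `|v - h z| < e / 2); last first.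
  exists M => x [w]; rewrite inE => /predU1P[->|ws] wx; last by apply: IH; exists w.
  by exfalso; apply: nz; exists x.
exists (Num.max M (mdist x0 z + L)) => x [w].
rewrite inE le_max => /predU1P[->|ws] wx; last first.
  by apply/orP; left; apply: IH; exists w.
apply/orP; right; rewrite (le_trans (metric_triangle _ z _))// lerD2l.
rewrite leNgt; apply/negP => /hL; apply/negP; rewrite -ltNge.
rewrite (le_lt_trans (ler_distD v _ _))// (splitr e) ltrD//.
by rewrite distrC.
Qed.

Section average.
Context (R : realType) (d : measure_display) (X : borelMetricType R d).
Variable mu : {measure set X -> \bar R}.

Lemma measurable_cball (x : X) (s : R) : measurable (cball x s).
Proof.
rewrite -[cball x s]setCK; apply: measurableC; apply: borel_measurable.
apply: sub_sigma_algebra => /=; rewrite openE => y /=/negP; rewrite -ltNge => sxy.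
apply/nbhs_ballP; exists (mdist x y - s) => /=; first by rewrite subr_gt0.
move=> z; rewrite ballEmdist/= ltrBrDl => yz.
apply/negP; rewrite -ltNge -(ltrD2r (mdist y z)) (lt_le_trans yz)//.
by rewrite (metric_sym y z) metric_triangle.
Qed.

(** An integral does not see null sets, so this holds at every [x]; pointwise formulas can then
    replace representatives known only almost everywhere. *)
Lemma average_ae (r : R) (f g : X -> R) (x : X) : measurable_fun setT f ->
  measurable_fun setT g -> f = g %[ae mu] -> average mu r f x = average mu r g x.
Proof.
move=> mf mg fg; rewrite /average /Rintegral; congr (_ * fine _).
apply: ae_eq_integral.
- exact: measurable_cball.
- by apply/measurable_EFinP; exact: measurable_funTS.
- by apply/measurable_EFinP; exact: measurable_funTS.
- by apply: filterS fg => y fgy _; rewrite fgy.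
Qed.

Lemma average_cst (r c : R) (f : X -> R) (x : X) : 0 < r ->
  balls_pos_finite mu -> (forall y, mdist x y <= r -> f y = c) ->
  average mu r f x = c.
Proof.
move=> r0 muB fc; rewrite /average.
rewrite (@eq_Rintegral _ _ _ _ _ (fun=> c)); last by move=> y /set_mem /fc.
rewrite Rintegral_cst; last exact: measurable_cball.
have [mu0 muoo] := muB x r r0.
by rewrite mulrCA mulVf ?mulr1// gt_eqF// fine_gt0// mu0 muoo.
Qed.

Variable E : banach_function_space mu.

Lemma measurable_bfs_fun (f : E) : measurable_fun setT (bfs_fun f).
Proof. exact: (measurable_funPT (repr (bfs_emb f))). Qed.

Lemma bfs_funB (f g : E) :
  bfs_fun (f - g) = (fun x => bfs_fun f x - bfs_fun g x) %[ae mu].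
Proof.
have := bfs_linear (bfsP E) (-1) g f.
rewrite scaleN1r addrC /bfs_fun; apply: filterS => x /[apply] ->.
by rewrite mulN1r addrC.
Qed.

Lemma average_opE (r : R) (EA : average_stable E r) (f : E) :
  bfs_fun (average_op EA f) = average mu r (bfs_fun f) %[ae mu].
Proof. exact: projT2 (cid (EA f)). Qed.

(** The infimum of the empty set is [+oo], so a strict upper bound also certifies that the class of
    [g] belongs to [E]. *)
Lemma fnorm_lt (g : X -> R) (k : \bar R) : (fnorm E g < k)%E ->
  exists f : E, bfs_fun f = g %[ae mu] /\ (`|f|%:E < k)%E.
Proof. by move=> /ereal_inf_lt[_ [f fg <-] fk]; exists f. Qed.

Lemma norm_ge_cst (alpha : set X -> R) (f : E) (A : set X) (c : R) :
  bfs_constants E alpha -> measurable A -> (mu A < +oo)%E ->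
  bfs_fun f = cst c %[ae mu in A] -> `|c| * fine (mu A) <= alpha A * `|f|.
Proof.
move=> alphaP mA Aoo fc; have [_ /(_ f)] := alphaP A mA Aoo.
rewrite (@ae_eq_integral _ _ _ mu A (cst `|c|%:E))//.
- by rewrite integral_cst//= -(@fineK _ (mu A)) ?ge0_fin_numE.
- apply/measurable_EFinP; apply: measurableT_comp => //.
  by apply: measurable_funTS; exact: measurable_bfs_fun.
- by apply: filterS fc => x /[apply]; rewrite /bfs_fun => ->.
Qed.

(* [bump x] is constant on every ball of radius [r] centered in [cball x r] and
   vanishes on every such ball centered outside [cball x (3 * r)]. *)
Let bump (alpha : set X -> R) (r : R) (x y : X) : R :=
  alpha (cball x r) * \1_(cball x (2 * r)) y / fine (mu (cball x r)).

Lemma measurable_bump alpha r x : measurable_fun setT (bump alpha r x).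
Proof.
apply: measurable_funM => //; apply: measurable_funM => //.
exact/measurable_indicP/measurable_cball.
Qed.

Lemma norm_average_op_sub (alpha : set X -> R) (r : R)
    (EA : average_stable E r) (x y : X) (f g : E) :
  balls_pos_finite mu -> 0 < r -> bfs_constants E alpha ->
  bfs_fun f = bump alpha r x %[ae mu] -> bfs_fun g = bump alpha r y %[ae mu] ->
  4 * r < mdist x y -> 1 <= `|average_op EA f - average_op EA g|.
Proof.
move=> muB r0 alphaP fx gy rxy.
have [mu0 muoo] := muB x r r0.
have m0 : 0 < fine (mu (cball x r)) by rewrite fine_gt0// mu0 muoo.
have mB := measurable_cball x r.
have [a0 _] := alphaP _ mB muoo.
set c := alpha (cball x r) / fine (mu (cball x r)).
have c0 : 0 < c by rewrite divr_gt0.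
(* Since [c] times the measure of the ball is [alpha (cball x r)], (B5) on this ball reads alpha <=
   alpha * norm, and the positive alpha cancels. *)
suff Hc : bfs_fun (average_op EA f - average_op EA g) = cst c
    %[ae mu in cball x r].
  have := norm_ge_cst _ _ _ _ alphaP mB muoo Hc.
  by rewrite gtr0_norm// /c divfK ?gt_eqF// ler_pMr.
near=> z => xz.
have /(_ I) -> : setT z -> bfs_fun (average_op EA f - average_op EA g) z =
    bfs_fun (average_op EA f) z - bfs_fun (average_op EA g) z.
  by near: z; exact: bfs_funB.
have /(_ I) -> : setT z -> bfs_fun (average_op EA f) z =
  average mu r (bfs_fun f) z by near: z; exact: average_opE.
have /(_ I) -> : setT z -> bfs_fun (average_op EA g) z =
  average mu r (bfs_fun g) z by near: z; exact: average_opE.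
rewrite (average_ae _ _ _ _ (measurable_bfs_fun f) (measurable_bump _ _ _) fx).
rewrite (average_ae _ _ _ _ (measurable_bfs_fun g) (measurable_bump _ _ _) gy).
(* For [z] in [cball x r], the ball of radius [r] about [z] lies in [cball x (2 * r)], where [bump]
   at [x] equals [c]. *)
rewrite (@average_cst _ c)// => [|w zw]; last first.
  rewrite /bump indicE mem_set ?mulr1// /cball/=.
  by rewrite (le_trans (metric_triangle _ z _))// mulr_natl mulr2n lerD.
(* A point [w] of that ball lying in [cball y (2 * r)] would give a distance from [x] to [y] of at
   most r + r + 2r = 4r. *)
rewrite (@average_cst _ 0) ?subr0// => w zw.
rewrite /bump indicE memNset ?mulr0 ?mul0r// /cball/= => yw.
move: rxy; apply/negP; rewrite -leNgt.
rewrite (le_trans (metric_triangle _ z _))//.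
have zy : mdist z y <= r + 2 * r.
  by rewrite (le_trans (metric_triangle _ w _))// lerD// metric_sym.
rewrite (le_trans (lerD xz zy))// addrA -mulr2n -[r *+ 2]mulr_natl -mulrDl.
by rewrite -natrD.
Unshelve. all: by end_near.
Qed.

End average.

Theorem theorem1p2 (R : realType) (d : measure_display)
    (X : borelMetricType R d) (mu : {measure set X -> \bar R})
    (muB : balls_pos_finite mu) (r : R) (r0 : 0 < r)
    (E : banach_function_space mu)
    (alpha : set X -> R) (alphaP : bfs_constants E alpha)
    (EA : average_stable E r)
    (Xr : doubling mu r)
    (sup2 : (ereal_sup [set fnorm E (fun y =>
        (alpha (cball x r) * \1_(cball x (2 * r)) y / fine (mu (cball x r)))%R)
      | x in [set: X]] < +oo)%E)
    (cA : compact_operator (average_op EA)) :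
  metric_bounded X.
Proof.
have [k supk] : exists k : R, (ereal_sup [set fnorm E (fun y =>
    (alpha (cball x r) * \1_(cball x (2 * r)) y / fine (mu (cball x r)))%R)
  | x in [set: X]] < k%:E)%E.
  (* The value [-oo] is the supremum over an empty [X]; any real [k] then works. *)
  case: (ereal_sup _) sup2 => [s _|//|_]; last by exists 0; rewrite ltNyr.
  by exists (s + 1); rewrite lte_fin ltrDl.
have /choice[F Fbump] : forall x : X, exists f : E,
    bfs_fun f = (fun y => alpha (cball x r) * \1_(cball x (2 * r)) y
      / fine (mu (cball x r))) %[ae mu] /\ (`|f|%:E < k%:E)%E.
  move=> x; apply: fnorm_lt; apply: le_lt_trans supk.
  by apply: ereal_sup_ubound; exists x.
apply: (precompact_separated_bounded (average_op EA \o F) (4 * r) 1) => //.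
- rewrite -(image_comp F); apply: cA.
  exists k; split; first exact: num_real.
  move=> M kM _ [x _ <-]; have [_] := Fbump x.
  by rewrite lte_fin => /lt_trans/(_ kM)/ltW.
- move=> x y; apply: norm_average_op_sub muB r0 alphaP _ _.
  + exact: (Fbump x).1.
  + exact: (Fbump y).1.
Qed.
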